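(* Let $v_{pp}^\infty$ be the exact far-field data and $v_{pp,\delta}^\infty\in L^2(\mathbb{S}\times\mathbb{S})$ noisy far-field data. For $z\in\mathbb{R}^2$, $d\in\mathbb{S}$ define $$\Psi_{pp}(z,d)=\int_{\mathbb{S}}v_{pp}^\infty(\hat x,d)\,\overline{\Xi_z^p(\hat x)}\,ds(\hat x),\qquad \Psi_{pp}^\delta(z,d)=\int_{\mathbb{S}}v_{pp,\delta}^\infty(\hat x,d)\,\overline{\Xi_z^p(\hat x)}\,ds(\hat x),$$ and the corresponding indicators $$I_P(z)=\left|\int_{\mathbb{S}}\Xi_z^p(d)\,\Psi_{pp}(z,d)\,ds(d)\right|,\qquad I_P^\delta(z)=\left|\int_{\mathbb{S}}\Xi_z^p(d)\,\Psi_{pp}^\delta(z,d)\,ds(d)\right|.$$ Then there exists a constant $C>0$, independent of the sampling point $z\in\mathbb{R}^2$, such that for all $z\in\mathbb{R}^2$ $$\bigl|I_P(z)-I_P^\delta(z)\bigr|\le C\,\bigl\|v_{pp}^\infty-v_{pp,\delta}^\infty\bigr\|_{L^2(\mathbb{S}\times\mathbb{S})}.$$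
   Context: $D\subset\mathbb{R}^2$ is a bounded, simply connected domain (a penetrable elastic obstacle) with smooth boundary $\partial D$, unit exterior normal $\nu=(\nu_1,\nu_2)^\top$ and unit tangent $\tau=(-\nu_2,\nu_1)^\top$. The mass densities satisfy $\rho_1,\rho_2>0$, the angular frequency $\omega>0$, and the real Lamé constants satisfy $\mu_i>0$, $\lambda_i+\mu_i>0$ ($i=1,2$). Set $\kappa_p=\omega\sqrt{\rho_2/(\lambda_2+2\mu_2)}$ and $\kappa_s=\omega\sqrt{\rho_2/\mu_2}$. $\mathbb{S}$ is the unit circle. For a vector field $w$, $\operatorname{curl}w=\partial_{x_1}w_2-\partial_{x_2}w_1$; for a scalar $v$, $\mathbf{curl}\,v=(\partial_{x_2}v,-\partial_{x_1}v)^\top$. The traction operators are $T_{\nu,i}(U)=2\mu_i\partial_\nu U+\lambda_i\nu(\nabla\cdot U)-\mu_i\tau\operatorname{curl}U$. For $d\in\mathbb{S}$ let $u_p(x)=d\,e^{\mathrm{i}\kappa_p x\cdot d}$ be the incident compressional plane wave. Let $U_1\in C^2(D)^2\cap C^1(\overline D)^2$ and $U_2\in C^2(\mathbb{R}^2\setminus\overline D)^2\cap C^1(\mathbb{R}^2\setminus D)^2$ be the solution of the elastic transmission problem with incident field $u_p$: $$\mu_1\Delta U_1+(\lambda_1+\mu_1)\nabla(\nabla\cdot U_1)+\rho_1\omega^2U_1=0\ \text{in }D,\qquad \mu_2\Delta U_2+(\lambda_2+\mu_2)\nabla(\nabla\cdot U_2)+\rho_2\omega^2U_2=0\ \text{in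 }\mathbb{R}^2\setminus\overline D,$$ $U_1=U_2$ and $T_{\nu,1}(U_1)=T_{\nu,2}(U_2)$ on $\partial D$, where the scattered field $v=U_2-u_p$ satisfies the Kupradze–Sommerfeld radiation condition: with $v_p=-\kappa_p^{-2}\nabla(\nabla\cdot v)$ and $v_s=\kappa_s^{-2}\mathbf{curl}(\operatorname{curl}v)$, $\lim_{r\to\infty}\sqrt r(\partial_rv_p-\mathrm{i}\kappa_pv_p)=0$ and $\lim_{r\to\infty}\sqrt r(\partial_rv_s-\mathrm{i}\kappa_sv_s)=0$, $r=|x|$, uniformly in all directions. The scattered field then has the asymptotic expansion $$v(x)=\frac{e^{\mathrm{i}\kappa_p|x|}}{\sqrt{|x|}}v_p^\infty(\hat x)\hat x+\frac{e^{\mathrm{i}\kappa_s|x|}}{\sqrt{|x|}}v_s^\infty(\hat x)\hat x^\perp+\mathcal O(|x|^{-3/2}),\quad |x|\to\infty,\ \hat x=x/|x|,$$ where $(x_1,x_2)^\perp=(-x_2,x_1)$. The function $v_{pp}^\infty(\hat x,d)$ denotes the compressional far-field pattern $v_p^\infty(\hat x)$ for the incident field $u_p$ with direction $d$; it is regarded as an element of $L^2(\mathbb{S}\times\mathbb{S})$. The noisy data $v_{pp,\delta}^\infty$ is an arbitrary complex-valued perturbation of it in $L^2(\mathbb{S}\times\mathbb{S})$. For $z\in\mathbb{R}^2$ and $\eta\in\mathbb{S}$, the test function is $\Xi_z^p(\eta)=e^{-\mathrm{i}\kappa_pz\cdot\eta}$. *)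

(* Defs.v *)
From HB Require Import structures.
From mathcomp Require Import all_boot all_order all_algebra.
From mathcomp Require Import complex.
From mathcomp Require Import all_classical all_reals all_analysis.
From mathcomp Require Import measurable_realfun.

Set Implicit Arguments.
Unset Strict Implicit.
Unset Printing Implicit Defensive.

Import Order.TTheory GRing.Theory Num.Theory.
Import numFieldNormedType.Exports.

Local Open Scope classical_set_scope.
Local Open Scope complex_scope.
Local Open Scope ring_scope.

(* The product R * R carries the max-norm, hence the usual topology; Euclidean
   lengths are written with [enorm]. *)
Notation plane R := (R * R)%type.
Notation cplane R := (R[i] * R[i])%type.

Section Plane.
Variable R : realType.
Implicit Types x y : plane R.

Definition dot x y : R := x.1 * y.1 + x.2 * y.2.
Definition enorm x : R := Num.sqrt (dot x x).
Definition perp x : plane R := (- x.2, x.1).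
Definition dir x : plane R := (enorm x)^-1 *: x.
Definition circle : set (plane R) := [set x | enorm x = 1].

Definition e1 : plane R := (1, 0).
Definition e2 : plane R := (0, 1).

Definition bdry (E : set (plane R)) : set (plane R) := closure E `\` E°.

Definition expi (t : R) : R[i] := cos t +i* sin t.

Definition cnorm (u : cplane R) : R := Num.sqrt (Normc.normc u.1 ^+ 2 + Normc.normc u.2 ^+ 2).

Definition cvec (x : plane R) : cplane R := (x.1%:C, x.2%:C).

End Plane.

Section Regularity.
Variable R : realType.
Implicit Types (E F D : set (plane R)) (f : plane R -> R).

(* Meant for open [E], where the two-sided partial derivatives are determined
   by the values of [f] on [E]. *)
Fixpoint Ck (k : nat) E f : Prop :=
  (forall x, E x -> {for x, continuous f}) /\
  match k with
  | 0%N => True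
  | k'.+1 =>
      (forall x, E x -> derivable f x (e1 R) /\ derivable f x (e2 R)) /\
      Ck k' E ('D_(e1 R) f) /\ Ck k' E ('D_(e2 R) f)
  end.

(* C^1 up to the closed set [F] in which [E] is dense: [f] is continuous on [F]
   and its first partials on [E] extend continuously to [F]. *)
Definition C1upto E F f : Prop :=
  [/\ Ck 1 E f,
      {within F, continuous f},
      exists2 g : plane R -> R, {within F, continuous g} &
        forall x, E x -> g x = 'D_(e1 R) f x &
      exists2 g : plane R -> R, {within F, continuous g} &
        forall x, E x -> g x = 'D_(e2 R) f x].

Definition real_components (U : plane R -> cplane R) (P : (plane R -> R) -> Prop) :=
  [/\ P (fun x => complex.Re (U x).1), P (fun x => complex.Im (U x).1),
      P (fun x => complex.Re (U x).2) & P (fun x => complex.Im (U x).2)].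

Definition simply_connected D : Prop :=
  connected D /\
  forall g : R -> plane R,
    {within `[0, 1], continuous g} -> g 0 = g 1 ->
    (forall t, 0 <= t <= 1 -> D (g t)) ->
  exists H : plane R -> plane R,
    {within `[0, 1] `*` `[0, 1], continuous H} /\
    forall s t, 0 <= s <= 1 -> 0 <= t <= 1 ->
      [/\ D (H (s, t)), H (0, t) = g t, H (1, t) = g 0,
          H (s, 0) = g 0 & H (s, 1) = g 0].

Definition rgrad f (x : plane R) : plane R := ('D_(e1 R) f x, 'D_(e2 R) f x).

Definition local_defining_function D (x0 : plane R) (V : set (plane R)) f :=
  [/\ open V, V x0, forall k, Ck k V f,
      forall x, V x -> rgrad f x <> 0 &
      V `&` D = V `&` [set x | f x < 0]].

Definition smooth_boundary D : Prop :=
  forall x0, bdry D x0 -> exists V f, local_defining_function D x0 V f.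

(* The defining function is negative inside, so its gradient points outwards. *)
Definition exterior_unit_normal D (nu : plane R -> plane R) : Prop :=
  forall x0, bdry D x0 -> forall V f, local_defining_function D x0 V f ->
    nu x0 = dir (rgrad f x0).

Definition smooth_sc_domain D : Prop :=
  [/\ open D, D !=set0, bounded_set D, simply_connected D & smooth_boundary D].

End Regularity.

Section VectorCalculus.
Variable R : realType.
Implicit Types (f : plane R -> R[i]) (U : plane R -> cplane R) (x : plane R).

Definition cderive (h : plane R) f x : R[i] :=
  'D_h (fun y => complex.Re (f y)) x +i* 'D_h (fun y => complex.Im (f y)) x.

Definition d1 f x := cderive (e1 R) f x.
Definition d2 f x := cderive (e2 R) f x.

Definition grad f x : cplane R := (d1 f x, d2 f x).
Definition vcurl f x : cplane R := (d2 f x, - d1 f x).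
Definition lap f x : R[i] := d1 (d1 f) x + d2 (d2 f) x.

Definition vlap U x : cplane R := (lap (fst \o U) x, lap (snd \o U) x).
Definition div U x : R[i] := d1 (fst \o U) x + d2 (snd \o U) x.
Definition curl U x : R[i] := d1 (snd \o U) x - d2 (fst \o U) x.

Definition rderive U x : cplane R :=
  (cderive (dir x) (fst \o U) x, cderive (dir x) (snd \o U) x).

(* Boundary value at [x] of a function given on [E]. *)
Definition trace (E : set (plane R)) f x : R[i] :=
  lim ((fun y => complex.Re (f y)) @ within E (nbhs x)) +i*
  lim ((fun y => complex.Im (f y)) @ within E (nbhs x)).

Definition normal_derivative E (n : plane R) U x : cplane R :=
  (n.1%:C * trace E (d1 (fst \o U)) x + n.2%:C * trace E (d2 (fst \o U)) x,
   n.1%:C * trace E (d1 (snd \o U)) x + n.2%:C * trace E (d2 (snd \o U)) x).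

Definition traction E (la mu : R) (n : plane R) U x : cplane R :=
  (2 * mu)%:C *: normal_derivative E n U x
  + (la%:C * trace E (div U) x) *: cvec n
  - (mu%:C * trace E (curl U) x) *: cvec (perp n).

Definition navier (la mu rho omega : R) U x : Prop :=
  mu%:C *: vlap U x + (la + mu)%:C *: grad (div U) x
  + (rho * omega ^+ 2)%:C *: U x = 0.

End VectorCalculus.

Section Scattering.
Variable R : realType.
Implicit Types (U v : plane R -> cplane R) (D : set (plane R)).

Definition kappa_p (la mu rho omega : R) := omega * Num.sqrt (rho / (la + 2 * mu)).
Definition kappa_s (mu rho omega : R) := omega * Num.sqrt (rho / mu).

Definition plane_wave_p (kp : R) (d x : plane R) : cplane R :=
  expi (kp * dot x d) *: cvec d.

(* Uniform in the direction of [x].  The fields [w] below are built from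
   solutions of constant-coefficient elliptic systems, hence are real-analytic
   away from the obstacle, so that [rderive] is the classical radial derivative. *)
Definition sommerfeld (k : R) (w : plane R -> cplane R) : Prop :=
  forall eps : R, 0 < eps -> exists r0 : R, forall x, r0 < enorm x ->
    Num.sqrt (enorm x) * cnorm (rderive w x - (0 +i* k) *: w x) < eps.

Definition kupradze (kp ks : R) v : Prop :=
  sommerfeld kp (fun x => (- kp ^- 2)%:C *: grad (div v) x) /\
  sommerfeld ks (fun x => (ks ^- 2)%:C *: vcurl (curl v) x).

Definition transmission_solution D (nu : plane R -> plane R)
    (la1 mu1 rho1 la2 mu2 rho2 omega : R) (uin U1 U2 : plane R -> cplane R) : Prop :=
  let Dext := ~` closure D in
  [/\ (* regularity *)
      real_components U1 (fun f => Ck 2 D f /\ C1upto D (closure D) f) /\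
      real_components U2 (fun f => Ck 2 Dext f /\ C1upto Dext (~` D) f),
      forall x, D x -> navier la1 mu1 rho1 omega U1 x,
      forall x, Dext x -> navier la2 mu2 rho2 omega U2 x,
      forall x, bdry D x ->
        U1 x = U2 x /\
        traction D la1 mu1 (nu x) U1 x = traction Dext la2 mu2 (nu x) U2 x &
      kupradze (kappa_p la2 mu2 rho2 omega) (kappa_s mu2 rho2 omega)
        (fun x => U2 x - uin x)].

Definition far_field_expansion (kp ks : R) v (vp vs : plane R -> R[i]) : Prop :=
  exists M r0 : R, 0 < r0 /\ forall x, r0 <= enorm x ->
    let r := enorm x in let xh := dir x in
    cnorm (v x
      - (expi (kp * r) * ((Num.sqrt r)^-1)%:C * vp xh) *: cvec xh
      - (expi (ks * r) * ((Num.sqrt r)^-1)%:C * vs xh) *: cvec (perp xh))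
    <= M * r `^ (- (3 / 2)).

(* [vpp (xh, d)] is the compressional far-field pattern at [xh] for the
   incident compressional plane wave of direction [d]. *)
Definition pp_far_field D (nu : plane R -> plane R)
    (la1 mu1 rho1 la2 mu2 rho2 omega : R) (vpp : plane R * plane R -> R[i]) : Prop :=
  let kp := kappa_p la2 mu2 rho2 omega in
  let ks := kappa_s mu2 rho2 omega in
  forall d, circle d -> exists U1 U2 : plane R -> cplane R,
    transmission_solution D nu la1 mu1 rho1 la2 mu2 rho2 omega
      (plane_wave_p kp d) U1 U2 /\
    exists vs : plane R -> R[i],
      far_field_expansion kp ks (fun x => U2 x - plane_wave_p kp d x)
        (fun xh => vpp (xh, d)) vs.

End Scattering.

Section ArcLength.
Variable R : realType.

Definition polar (t : measurableTypeR R) : plane R := (cos t, sin t).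

Lemma measurable_polar : measurable_fun [set: measurableTypeR R] polar.
Proof.
apply/measurable_fun_pairP; split; apply: continuous_measurable_fun.
- exact: continuous_cos.
- exact: continuous_sin.
Qed.

(* Arc length measure of the unit circle, as a Borel measure on the plane. *)
Definition arc_length : set (plane R) -> \bar R :=
  pushforward (mrestr (@lebesgue_measure R) (measurable_itv `[0, 2 * pi[)) polar.



Let restr : {measure set (measurableTypeR R) -> \bar R} :=
  mrestr (@lebesgue_measure R) (measurable_itv `[0, 2 * pi[).

Let arc0 : arc_length set0 = 0%E.
Proof. by rewrite /arc_length /pushforward preimage_set0 measure0. Qed.

Let arc_ge0 A : (0 <= arc_length A)%E.
Proof. exact: (measure_ge0 restr). Qed.

Let measurable_preimage_polar A : measurable A -> measurable (polar @^-1` A).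
Proof. by move=> mA; rewrite -[X in measurable X]setTI; exact: measurable_polar. Qed.

Let arc_sigma_additive : semi_sigma_additive arc_length.
Proof.
move=> F mF tF mUF; rewrite /arc_length /pushforward preimage_bigcup.
apply: (measure_semi_sigma_additive (s := restr)).
- by move=> n; exact: measurable_preimage_polar.
- apply/trivIsetP => i j _ _ ij; rewrite -preimage_setI.
  by move/trivIsetP : tF => /(_ _ _ _ _ ij) -> //; rewrite preimage_set0.
- by rewrite -preimage_bigcup; exact: measurable_preimage_polar.
Qed.

HB.instance Definition _ := isMeasure.Build _ _ _ arc_length
  arc0 arc_ge0 arc_sigma_additive.

Let arc_finite : fin_num_fun arc_length.
Proof.
move=> A mA; rewrite ge0_fin_numE; last exact: measure_ge0.
apply: (@le_lt_trans _ _ (@lebesgue_measure R `[0, 2 * pi[)).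
  apply: le_measure; rewrite ?inE; [| exact: measurable_itv | by move=> x []].
  by apply: measurableI; [exact: measurable_preimage_polar|exact: measurable_itv].
by rewrite lebesgue_measure_itv; case: ifP => _; rewrite /= ?ltry.
Qed.

HB.instance Definition _ := @Measure_isFinite.Build _ _ _ arc_length arc_finite.

End ArcLength.

Section Indicators.
Variable R : realType.
Implicit Types (F : plane R * plane R -> R[i]) (z d xh eta : plane R).

Definition circle_integral (f : plane R -> R[i]) : R[i] :=
  (\int[@arc_length R]_(x in @circle R) complex.Re (f x)) +i*
  (\int[@arc_length R]_(x in @circle R) complex.Im (f x)).

Definition torus : set (plane R * plane R) := @circle R `*` @circle R.

(* Values of [F] off the torus are discarded. *)
Definition L2_norm F : \bar R :=
  Lnorm (@arc_length R \x @arc_length R)%E 2%:E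
    (fun p => (Normc.normc (F p) * \1_torus p)%:E).

(* A class in L^2 of the torus is given by a Borel representative. *)
Definition in_L2 F : Prop :=
  [/\ measurable_fun torus (fun p => complex.Re (F p)),
      measurable_fun torus (fun p => complex.Im (F p)) &
      (L2_norm F < +oo)%E].

Definition Xi_p (kp : R) z eta : R[i] := expi (- (kp * dot z eta)).

Definition Psi (kp : R) F z d : R[i] :=
  circle_integral (fun xh => F (xh, d) * (Xi_p kp z xh)^*).

Definition I_P (kp : R) F z : R :=
  Normc.normc (circle_integral (fun d => Xi_p kp z d * Psi kp F z d)).

End Indicators.

(* Main.v *)
Require Import Defs.
From mathcomp Require Import all_boot all_order all_algebra.
From mathcomp Require Import complex.
From mathcomp Require Import all_classical all_reals all_analysis.
From mathcomp Require Import measurable_realfun lra.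

(** The indicator is the modulus of an integral over the torus,
      I_P(z) = | int_(S x S) K_z(x, d) F(x, d) ds(x) ds(d) |,
    where the kernel K_z(x, d) = Xi_z(d) * conj (Xi_z(x)) has modulus 1 whatever
    z is.  Hence
      |I_P(z) - I_P^delta(z)| <= | int K_z (F - F^delta) |
                              <= int |F - F^delta| <= 2 pi ||F - F^delta||_2,
    by the reverse triangle inequality, the bound of the modulus of an integral
    by the integral of the modulus, and the Cauchy-Schwarz inequality against
    the constant 1, whose L^2 norm on the torus is 2 pi.  The constant does not
    depend on z because |K_z| does not.

    The only delicate point is the first formula.  The indicator is an iterated
    integral, and the inner integral Psi(z, d) is a convergent one only for
    almost every d; at the other directions it has a conventional value that
    does not commute with the multiplication by Xi_z(d).  These directions form
    a null set, so Fubini's theorem still applies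
    ([cintegral_prod_weighted], [I_P_torus]).  The L^1 bound is
    [integral_normc_le_L2], and [dist_I_P_le_L2] puts the pieces together. *)

Set Implicit Arguments.
Unset Strict Implicit.
Unset Printing Implicit Defensive.

Import Order.TTheory GRing.Theory Num.Theory.
Import numFieldNormedType.Exports.

Local Open Scope classical_set_scope.
Local Open Scope ring_scope.

(** * Modulus of complex numbers *)

Section Modulus.
Variable R : realType.
Implicit Types a b z : R[i].

Lemma ReM a b : complex.Re (a * b) =
  complex.Re a * complex.Re b - complex.Im a * complex.Im b.
Proof. by case: a b => [a1 a2] [b1 b2]. Qed.

Lemma ImM a b : complex.Im (a * b) =
  complex.Re a * complex.Im b + complex.Im a * complex.Re b.
Proof. by case: a b => [a1 a2] [b1 b2]. Qed.

Lemma normcE_sqrt z : Normc.normc z =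
  Num.sqrt (complex.Re z ^+ 2 + complex.Im z ^+ 2).
Proof. by case: z. Qed.

Lemma normc_ge0 z : 0 <= Normc.normc z.
Proof. by rewrite normcE_sqrt sqrtr_ge0. Qed.

Lemma normr_Re_le z : `|complex.Re z| <= Normc.normc z.
Proof.
by rewrite normcE_sqrt -sqrtr_sqr ler_wsqrtr// lerDl sqr_ge0.
Qed.

Lemma normr_Im_le z : `|complex.Im z| <= Normc.normc z.
Proof.
by rewrite normcE_sqrt -sqrtr_sqr ler_wsqrtr// lerDr sqr_ge0.
Qed.

Lemma normc_le_ReIm z :
  Normc.normc z <= `|complex.Re z| + `|complex.Im z|.
Proof.
rewrite normcE_sqrt -[leRHS]ger0_norm ?addr_ge0//.
rewrite -[leRHS]sqrtr_sqr ler_wsqrtr// sqrrD !real_normK ?num_real//.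
by rewrite addrAC lerDl mulrn_wge0// mulr_ge0.
Qed.

Lemma ler_dist_normc a b :
  `|Normc.normc a - Normc.normc b| <= Normc.normc (a - b).
Proof.
have tri (x y : R[i]) : Normc.normc x - Normc.normc y <= Normc.normc (x - y).
  by rewrite lerBlDr (le_trans _ (le_normcD _ _))// subrK.
by rewrite ler_norml tri andbT lerNl opprB (le_trans (tri _ _))// -normcN opprB.
Qed.

Lemma normc_expi (t : R) : Normc.normc (expi t) = 1.
Proof. by rewrite normcE_sqrt/= cos2Dsin2 sqrtr1. Qed.

Lemma normc_conj z : Normc.normc (z^*)%C = Normc.normc z.
Proof. by case: z => a b; rewrite !normcE_sqrt/= sqrrN. Qed.

Lemma unimodular_phase z :
  exists2 u : R[i], Normc.normc u = 1 & u * z = (Normc.normc z)%:C%C.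
Proof.
have [->|z0] := eqVneq z 0.
  by exists 1; rewrite ?Normc.normc1// Normc.normc0 mulr0.
have nz0 : Normc.normc z != 0 by apply: contra_neq z0; exact: Normc.eq0_normc.
have nz1 : Normc.normc (Normc.normc z)%:C%C = Normc.normc z.
  by rewrite normcE_sqrt/= expr0n addr0 sqrtr_sqr ger0_norm// normc_ge0.
exists ((Normc.normc z)%:C%C / z); last by rewrite divfK.
by rewrite Normc.normcM Normc.normcV nz1 divff.
Qed.

End Modulus.

(** * Integration of complex-valued functions *)

Section ComplexIntegral.
Context {d} {T : measurableType d} {R : realType}.
Implicit Types (D : set T) (f g u : T -> R[i]).

Definition cmeasurable D f :=
  measurable_fun D (fun x => complex.Re (f x)) /\
  measurable_fun D (fun x => complex.Im (f x)).

Lemma cmeasurableM D f g :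
  cmeasurable D f -> cmeasurable D g -> cmeasurable D (fun x => f x * g x).
Proof.
move=> [f1 f2] [g1 g2]; split.
  by under eq_fun do rewrite ReM; apply: measurable_funB; exact: measurable_funM.
by under eq_fun do rewrite ImM; apply: measurable_funD; exact: measurable_funM.
Qed.

Lemma measurable_normc D f :
  cmeasurable D f -> measurable_fun D (fun x => Normc.normc (f x)).
Proof.
move=> [f1 f2]; under eq_fun do rewrite normcE_sqrt.
apply: (measurableT_comp (continuous_measurable_fun (@sqrt_continuous R))).
by apply: measurable_funD; exact: measurable_funX.
Qed.

Variable mu : {measure set T -> \bar R}.

Definition cintegrable D f :=
  mu.-integrable D (EFin \o (fun x => complex.Re (f x))) /\
  mu.-integrable D (EFin \o (fun x => complex.Im (f x))).

Definition cintegral D f : R[i] := Complex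
  (\int[mu]_(x in D) complex.Re (f x)) (\int[mu]_(x in D) complex.Im (f x)).

Lemma cintegrable_cmeasurable D f : cintegrable D f -> cmeasurable D f.
Proof.
by move=> [f1 f2]; split; apply/measurable_EFinP;
  [exact: measurable_int f1|exact: measurable_int f2].
Qed.

(** Each of |Re f| and |Im f| is at most |f|, which is at most their sum; the
    modulus is the convenient form for multiplying by unimodular factors. *)
Lemma cintegrable_normc D f : measurable D ->
  cintegrable D f <->
  cmeasurable D f /\ mu.-integrable D (EFin \o (fun x => Normc.normc (f x))).
Proof.
move=> mD; split=> [if_|[mf nf]].
  have mf := cintegrable_cmeasurable if_; split => //.
  have [/integrable_abse f1 /integrable_abse f2] := if_.
  apply: (le_integrable mD _ _ (integrableD mD f1 f2)).
    exact/measurable_EFinP/measurable_normc.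
  move=> x _ /=; rewrite lee_fin ger0_norm ?normc_ge0// ger0_norm ?addr_ge0//.
  exact: normc_le_ReIm.
split; apply: (le_integrable mD _ _ nf).
- by apply/measurable_EFinP; case: mf.
- move=> x _ /=; rewrite lee_fin (ger0_norm (normc_ge0 _)); exact: normr_Re_le.
- by apply/measurable_EFinP; case: mf.
- move=> x _ /=; rewrite lee_fin (ger0_norm (normc_ge0 _)); exact: normr_Im_le.
Qed.

Lemma cintegrable_unimodularM D u f : measurable D ->
  cmeasurable D u -> (forall x, Normc.normc (u x) = 1) ->
  cintegrable D f -> cintegrable D (fun x => u x * f x).
Proof.
move=> mD mu_ u1 /(cintegrable_normc _ mD)[mf nf].
apply/(cintegrable_normc _ mD); split; first exact: cmeasurableM.
by rewrite (_ : (fun x => _) = (fun x => Normc.normc (f x)))//;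
  apply/funext => x; rewrite Normc.normcM u1 mul1r.
Qed.

Lemma cintegralZl D (c : R[i]) f : measurable D ->
  cintegrable D f -> cintegral D (fun x => c * f x) = c * cintegral D f.
Proof.
move=> mD [f1 f2].
have Z (r : R) (g : T -> R) : mu.-integrable D (EFin \o g) ->
    mu.-integrable D (EFin \o (fun x => r * g x)).
  by move=> ig; have := integrableZl mD r ig; apply: eq_integrable => // x _.
apply/eqP; rewrite eq_complex ReM ImM /=; apply/andP; split; apply/eqP.
  under eq_Rintegral do rewrite ReM.
  by rewrite RintegralB ?RintegralZl//; exact: Z.
under eq_Rintegral do rewrite ImM.
by rewrite RintegralD ?RintegralZl//; exact: Z.
Qed.

Lemma cintegralB D f g : measurable D ->
  cintegrable D f -> cintegrable D g ->
  cintegral D (fun x => f x - g x) = cintegral D f - cintegral D g.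
Proof.
move=> mD [f1 f2] [g1 g2]; rewrite /cintegral.
under eq_Rintegral do rewrite raddfB/=.
rewrite RintegralB//; under [X in Complex _ X]eq_Rintegral do rewrite raddfB/=.
by rewrite RintegralB.
Qed.

Lemma cintegrableB D f g : measurable D ->
  cintegrable D f -> cintegrable D g -> cintegrable D (fun x => f x - g x).
Proof.
move=> mD [f1 f2] [g1 g2]; split.
  under [X in EFin \o X]eq_fun do rewrite raddfB/=.
  exact: (integrableB mD f1 g1).
under [X in EFin \o X]eq_fun do rewrite raddfB/=.
exact: (integrableB mD f2 g2).
Qed.

(** Rotating f by a constant phase makes its integral real and nonnegative, and
    then the pointwise bound Re (u f) <= |f| can be integrated without losing a
    constant factor. *)
Lemma le_normc_cintegral D f : measurable D -> cintegrable D f ->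
  Normc.normc (cintegral D f) <= \int[mu]_(x in D) Normc.normc (f x).
Proof.
move=> mD if_; have [u u1 uf] := unimodular_phase (cintegral D f).
have mcu : cmeasurable D (cst u) by split; exact: measurable_cst.
have iuf := cintegrable_unimodularM mD mcu (fun=> u1) if_.
have [_ nf] := (cintegrable_normc f mD).1 if_.
have : complex.Re (cintegral D (fun x => u * f x)) = Normc.normc (cintegral D f).
  by rewrite cintegralZl// uf.
move=> /= <-; apply: le_Rintegral => //; first by case: iuf.
move=> x _; rewrite (le_trans (ler_norm _))// (le_trans (normr_Re_le _))//.
by rewrite Normc.normcM u1 mul1r.
Qed.

Lemma ae_eq_cintegral D f g : measurable D ->
  cmeasurable D f -> cmeasurable D g ->
  {ae mu, forall x, D x -> f x = g x} -> cintegral D f = cintegral D g.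
Proof.
move=> mD [f1 f2] [g1 g2] fg; congr Complex; congr fine;
  apply: ae_eq_integral => //; try exact/measurable_EFinP;
  by apply: filterS fg => x fgx Dx; rewrite fgx.
Qed.

End ComplexIntegral.

(** * Iterated integrals over a rectangle *)

Section Fubini.
Context d1 d2 (T1 : measurableType d1) (T2 : measurableType d2) (R : realType).
Variable m1 : {sigma_finite_measure set T1 -> \bar R}.
Variable m2 : {sigma_finite_measure set T2 -> \bar R}.
Variables (A : set T1) (B : set T2).
Hypotheses (mA : measurable A) (mB : measurable B).

(** Extending f by 0 outside the rectangle reduces integrals over A x B to
    Fubini's theorem on the whole product space. *)
Lemma fubini_G_restrict (f : T1 * T2 -> R) :
  fubini_G m1 ((EFin \o f) \_ (A `*` B)) =
  (fun y => \int[m1]_(x in A) (f (x, y))%:E)%E \_ B.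
Proof.
apply/funext => y; rewrite /fubini_G patchE; case: ifPn => yB.
  rewrite [RHS]integral_mkcond; apply: eq_integral => x _.
  by rewrite !patchE in_setX yB andbT.
by apply: integral0_eq => x _; rewrite patchE in_setX (negbTE yB) andbF.
Qed.

Section real.
Variable f : T1 * T2 -> R.
Hypothesis imf : (m1 \x m2)%E.-integrable (A `*` B) (EFin \o f).

Let imfT : (m1 \x m2)%E.-integrable setT ((EFin \o f) \_ (A `*` B)).
Proof. by apply/(integrable_mkcond (EFin \o f)) => //; exact: measurableX. Qed.

Lemma ae_integrable_section :
  {ae m2, forall y, B y -> m1.-integrable A (EFin \o (fun x => f (x, y)))}.
Proof.
apply: filterS (ae_integrable2 imfT) => y + By.
move=> iy; apply/(integrable_mkcond _ mA).
rewrite (_ : _ \_ _ = (fun x => ((EFin \o f) \_ (A `*` B)) (x, y)))//.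
by apply/funext => x; rewrite !patchE in_setX (mem_set By) andbT.
Qed.

Let G y := (\int[m1]_(x in A) (f (x, y))%:E)%E.

Let iG : m2.-integrable B G.
Proof.
apply/(integrable_mkcond _ mB); rewrite -fubini_G_restrict.
have mf := measurable_int _ imfT.
apply/integrableP; split; first exact: (measurable_fubini_G imfT).
have lty := (integrable21ltyP m1 m2 mf).1 imfT.
apply: (le_lt_trans _ lty).
apply: ge0_le_integral => //.
- by apply: measurableT_comp => //; exact: (measurable_fubini_G imfT).
- apply: (measurable_fun_fubini_tonelli_G (abse \o _)) => //=.
  exact: measurableT_comp.
- by move=> y _; apply: le_abse_integral => //; exact: measurableT_comp.
Qed.

(** The real-valued inner integral is 0 where the extended one is infinite, so
    it is dominated by the latter everywhere. *)
Lemma integrable_Rintegral_section :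
  m2.-integrable B (EFin \o (fun y => \int[m1]_(x in A) f (x, y))).
Proof.
apply: (le_integrable mB _ _ iG).
  apply/measurable_EFinP; apply: measurableT_comp => //.
  exact: measurable_int iG.
move=> y _ /=; rewrite /Rintegral -/(G y).
by case: (G y) => [r| |]//=; rewrite normr0 leey.
Qed.

(** The real-valued and the extended inner integrals differ only where the
    latter is infinite, which is a null set of y. *)
Lemma Rintegral_prod :
  \int[m2]_(y in B) (\int[m1]_(x in A) f (x, y)) =
  \int[(m1 \x m2)%E]_(p in A `*` B) f p.
Proof.
congr fine; rewrite [RHS]integral_mkcond -integral21_prod_meas1//.
rewrite -/(fubini_G _ _) fubini_G_restrict -integral_mkcond.
apply: ae_eq_integral => //.
- exact: measurable_int integrable_Rintegral_section.
- exact: measurable_int iG.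
- apply: filterS (integrable_ae mB iG) => y /= Gfin By.
  by rewrite /Rintegral fineK//; exact: Gfin.
Qed.

End real.

End Fubini.

Section ComplexFubini.
Context d1 d2 (T1 : measurableType d1) (T2 : measurableType d2) (R : realType).
Variable m1 : {sigma_finite_measure set T1 -> \bar R}.
Variable m2 : {sigma_finite_measure set T2 -> \bar R}.
Variables (A : set T1) (B : set T2).
Hypotheses (mA : measurable A) (mB : measurable B).

(** The weight u y can be moved inside the inner integral only when the section
    f (., y) is integrable, that is for almost every y; elsewhere the real and
    imaginary parts of the inner integral may have unrelated conventional
    values, which multiplication by u y would mix. *)
Lemma cintegral_prod_weighted (u : T2 -> R[i]) (f : T1 * T2 -> R[i]) :
  cmeasurable setT u -> (forall y, Normc.normc (u y) = 1) ->
  cintegrable (m1 \x m2)%E (A `*` B) f ->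
  cintegral m2 B (fun y => u y * cintegral m1 A (fun x => f (x, y))) =
  cintegral (m1 \x m2)%E (A `*` B) (fun p => u p.2 * f p).
Proof.
move=> [mu1 mu2] u1 if_.
have iuf : cintegrable (m1 \x m2)%E (A `*` B) (fun p => u p.2 * f p).
  apply: cintegrable_unimodularM => //; first exact: measurableX.
  split; apply: measurable_funTS.
    exact: (measurableT_comp mu1 measurable_snd).
  exact: (measurableT_comp mu2 measurable_snd).
have [if1 if2] := if_; have [iuf1 iuf2] := iuf.
transitivity (cintegral m2 B (fun y => cintegral m1 A (fun x => u y * f (x, y)))).
  apply: ae_eq_cintegral => //.
  - apply: cmeasurableM; first by split; exact: measurable_funTS.
    apply: (@cintegrable_cmeasurable _ _ _ m2).
    split; first exact: (integrable_Rintegral_section mA mB if1).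
    exact: (integrable_Rintegral_section mA mB if2).
  - apply: (@cintegrable_cmeasurable _ _ _ m2); split.
      exact: (integrable_Rintegral_section mA mB iuf1).
    exact: (integrable_Rintegral_section mA mB iuf2).
  apply: filterS2 (ae_integrable_section mA mB if1)
                  (ae_integrable_section mA mB if2) => y + + By.
  by move=> /(_ By) i1 /(_ By) i2; rewrite cintegralZl.
congr Complex.
  exact: (Rintegral_prod mA mB iuf1).
exact: (Rintegral_prod mA mB iuf2).
Qed.

End ComplexFubini.

(** * Arc length on the torus and the indicator *)

Section Torus.
Variable R : realType.
Implicit Types (F : plane R * plane R -> R[i]) (z : plane R).

Local Notation arc := (@arc_length R).
Local Notation arc2 := (arc \x arc)%E.

Lemma measurable_circle : measurable (@circle R).
Proof.
have mn : measurable_fun [set: plane R] (@enorm R).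
  apply: (measurableT_comp (continuous_measurable_fun (@sqrt_continuous R))).
  by apply: measurable_funD; apply: measurable_funM.
rewrite (_ : @circle R = setT `&` @enorm R @^-1` [set 1]); last first.
  by rewrite setTI.
exact: mn.
Qed.

Lemma measurable_torus : measurable (@torus R).
Proof. by apply: measurableX; exact: measurable_circle. Qed.

Lemma arc_lengthT : arc setT = (2 * pi)%:E.
Proof.
rewrite /arc_length /pushforward preimage_setT /mrestr setTI.
by rewrite lebesgue_measure_itv/= lte_fin mulr_gt0 ?pi_gt0// sube0.
Qed.

Lemma arc2T : arc2 setT = ((2 * pi) ^+ 2)%:E.
Proof.
transitivity (arc setT * arc setT)%E.
  by rewrite -setXTT; exact: (product_measure1E arc arc).
by rewrite arc_lengthT -EFinM expr2.
Qed.

(** Cauchy-Schwarz against the constant 1, whose norm is the square root of the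
    total mass (2 pi)^2 of the product of the arc lengths. *)
Lemma integral_normc_le_L2 F : cmeasurable (@torus R) F ->
  (\int[arc2]_(p in @torus R) (Normc.normc (F p))%:E <= (2 * pi)%:E * L2_norm F)%E.
Proof.
move=> mF.
have mf : measurable_fun setT (fun p => Normc.normc (F p) * \1_(@torus R) p).
  have := (measurable_restrictT _ measurable_torus).1 (measurable_normc mF).
  rewrite (_ : _ \_ _ = (fun p => Normc.normc (F p) * \1_(@torus R) p))//.
  by apply/funext => p; rewrite patchE indicE; case: ifPn; rewrite ?mulr1 ?mulr0.
have := hoelder arc2 mf (measurable_cst (1 : R)) (ltr0Sn _ 1) (ltr0Sn _ 1).
have -> : (2^-1 + 2^-1 : R) = 1 by lra.
move=> /(_ erefl); rewrite Lnorm1 muleC.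
have -> : 'N[arc2]_2%:E[EFin \o cst 1%R]%E = (2 * pi)%:E.
  transitivity (((2 * pi : R) ^+ 2)%:E `^ 2^-1)%E.
    by rewrite -arc2T; exact: Lnorm_cst1.
  rewrite poweR12_sqrt ?lee_fin ?sqr_ge0//=.
  by rewrite sqrtr_sqr ger0_norm// mulr_ge0// pi_ge0.
apply: le_trans; rewrite [leLHS]integral_mkcond le_eqVlt; apply/orP; left.
apply/eqP/eq_integral => p _ /=.
rewrite patchE mulr1 ger0_norm ?mulr_ge0 ?normc_ge0// indicE.
by case: ifPn; rewrite ?mulr1 ?mulr0.
Qed.

Lemma in_L2_cintegrable F : in_L2 F -> cintegrable arc2 (@torus R) F.
Proof.
move=> [mF1 mF2 F2]; have mF : cmeasurable (@torus R) F by [].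
apply/cintegrable_normc; first exact: measurable_torus.
split => //; apply/integrableP; split.
  exact/measurable_EFinP/measurable_normc.
under eq_integral do rewrite gee0_abs ?lee_fin ?normc_ge0//.
apply: le_lt_trans (integral_normc_le_L2 mF) _.
by rewrite lte_mul_pinfty// lee_fin mulr_ge0// pi_ge0.
Qed.

(** The first component of p is the observation direction, the second one the
    incident direction. *)
Definition sampling_kernel (kp : R) z (p : plane R * plane R) : R[i] :=
  Xi_p kp z p.2 * ((Xi_p kp z p.1)^*)%C.

Lemma cmeasurable_Xi_p (kp : R) z : cmeasurable setT (Xi_p kp z).
Proof.
have mt : measurable_fun setT (fun eta : plane R => - (kp * dot z eta)).
  apply: measurable_funN => //; apply: measurable_funM => //.
  by apply: measurable_funD; apply: measurable_funM.
split.
  exact: (measurableT_comp (continuous_measurable_fun (@continuous_cos R)) mt).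
exact: (measurableT_comp (continuous_measurable_fun (@continuous_sin R)) mt).
Qed.

Lemma normc_Xi_p (kp : R) z eta : Normc.normc (Xi_p kp z eta) = 1.
Proof. exact: normc_expi. Qed.

Lemma cmeasurable_conj_Xi_p (kp : R) z :
  cmeasurable setT (fun eta => ((Xi_p kp z eta)^*)%C).
Proof.
by have [mr mi] := cmeasurable_Xi_p kp z; split=> //=; exact: measurable_funN.
Qed.

Lemma cmeasurable_sampling_kernel (kp : R) z :
  cmeasurable setT (sampling_kernel kp z).
Proof.
have [u1 u2] := cmeasurable_Xi_p kp z.
have [v1 v2] := cmeasurable_conj_Xi_p kp z.
apply: cmeasurableM; split.
- exact: (measurableT_comp u1 measurable_snd).
- exact: (measurableT_comp u2 measurable_snd).
- exact: (measurableT_comp v1 measurable_fst).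
- exact: (measurableT_comp v2 measurable_fst).
Qed.

Lemma cintegrable_sampling_kernelM (kp : R) z F :
  cintegrable arc2 (@torus R) F ->
  cintegrable arc2 (@torus R) (fun p => sampling_kernel kp z p * F p).
Proof.
move=> iF; have [k1 k2] := cmeasurable_sampling_kernel kp z.
apply: cintegrable_unimodularM iF; first exact: measurable_torus.
- by split; exact: measurable_funTS.
- by move=> p; rewrite Normc.normcM normc_conj !normc_Xi_p mulr1.
Qed.

(** Fubini's theorem with the weight Xi_z(d), which depends on the outer
    variable only. *)
Lemma I_P_torus (kp : R) z F : cintegrable arc2 (@torus R) F ->
  I_P kp F z = Normc.normc
    (cintegral arc2 (@torus R) (fun p => sampling_kernel kp z p * F p)).
Proof.
move=> iF; congr Normc.normc.
have [v1 v2] := cmeasurable_conj_Xi_p kp z.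
have iG : cintegrable arc2 (@torus R)
    (fun p => ((Xi_p kp z p.1)^*)%C * F p).
  apply: cintegrable_unimodularM iF; first exact: measurable_torus.
    split; apply: measurable_funTS.
      exact: (measurableT_comp v1 measurable_fst).
    exact: (measurableT_comp v2 measurable_fst).
  by move=> p; rewrite normc_conj normc_Xi_p.
rewrite (_ : (fun p => _) =
  (fun p => Xi_p kp z p.2 * (((Xi_p kp z p.1)^*)%C * F p))); last first.
  by apply/funext => p; rewrite mulrA.
have u0 eta : Normc.normc (Xi_p kp z eta) = 1 by exact: normc_Xi_p.
have E := cintegral_prod_weighted measurable_circle measurable_circle
  (cmeasurable_Xi_p kp z) u0 iG.
apply: etrans E.
congr (circle_integral _); apply/funext => d; congr (_ * circle_integral _).
by apply/funext => x; rewrite mulrC.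
Qed.

Lemma dist_I_P_le_L2 (kp : R) z F G : in_L2 F -> in_L2 G ->
  (`|I_P kp F z - I_P kp G z|%:E
    <= (2 * pi)%:E * L2_norm (fun p => (F p - G p)%R))%E.
Proof.
move=> /in_L2_cintegrable iF /in_L2_cintegrable iG.
have mt := measurable_torus.
have iH := cintegrableB mt iF iG.
have [mH nH] := (cintegrable_normc _ _ mt).1 iH.
apply: le_trans (integral_normc_le_L2 mH).
rewrite -[leRHS]fineK; last exact: integrable_fin_num.
rewrite lee_fin !I_P_torus// (le_trans (ler_dist_normc _ _))//.
rewrite -cintegralB//; try exact: cintegrable_sampling_kernelM.
under [X in cintegral _ _ X]eq_fun do rewrite -mulrBr.
apply: (le_trans (le_normc_cintegral mt (cintegrable_sampling_kernelM kp z iH))).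
rewrite /Rintegral; under eq_integral do
  rewrite Normc.normcM Normc.normcM normc_conj !normc_Xi_p !mul1r.
exact: lexx.
Qed.

End Torus.

Unset Implicit Arguments.

Theorem theorem4 (R : realType)
    (D : set (plane R)) (nu : plane R -> plane R)
    (la1 mu1 rho1 la2 mu2 rho2 omega : R)
    (vpp : plane R * plane R -> R[i]) :
  smooth_sc_domain D ->
  exterior_unit_normal D nu ->
  0 < rho1 -> 0 < rho2 -> 0 < omega ->
  0 < mu1 -> 0 < la1 + mu1 -> 0 < mu2 -> 0 < la2 + mu2 ->
  pp_far_field D nu la1 mu1 rho1 la2 mu2 rho2 omega vpp ->
  in_L2 vpp ->
  let kp := kappa_p la2 mu2 rho2 omega in
  exists C : R, 0 < C /\
    forall vpp_delta : plane R * plane R -> R[i], in_L2 vpp_delta ->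
    forall z : plane R,
    (`|I_P kp vpp z - I_P kp vpp_delta z|%:E
      <= C%:E * L2_norm (fun p => (vpp p - vpp_delta p)%R))%E.
Proof.
move=> _ _ _ _ _ _ _ _ _ _ vppL2 kp; exists (2 * pi).
split=> [|vpp_delta deltaL2 z]; first by rewrite mulr_gt0 ?pi_gt0.
exact: dist_I_P_le_L2.
Qed.
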